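(* Let $n,m$ be positive integers, let $(p,q)\in\mathbb{C}^2$ be a nonzero vector, and let $f:\mathbb{R}\to\mathbb{C}$ be a measurable function satisfying $$\sum_{k\in\mathbb{Z}} f(x-kn)=p,\qquad \sum_{k\in\mathbb{Z}} f(x-km)=q\qquad\text{for a.e. } x\in\mathbb{R},$$ where both series converge absolutely for a.e. $x$. Then $$\operatorname{mes}(\operatorname{supp} f)\ge n+m-\gcd(n,m).$$
   Context: The support of a function $f$ is the set $\operatorname{supp} f=\{x: f(x)\ne 0\}$ (no closure is taken). $\operatorname{mes}$ denotes Lebesgue measure on $\mathbb{R}$. *)

(* Defs.v *)
From mathcomp Require Import all_boot all_order all_algebra finmap.
From mathcomp Require Import complex.
From mathcomp Require Import all_classical all_reals all_analysis.
From mathcomp Require Import summability.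

Set Implicit Arguments.
Unset Strict Implicit.
Unset Printing Implicit Defensive.

Import Order.TTheory GRing.Theory Num.Theory.
Import numFieldNormedType.Exports.

Local Open Scope classical_set_scope.
Local Open Scope ring_scope.

(* The real line with its Lebesgue (i.e. Caratheodory-measurable, hence
   complete) sigma-algebra; the canonical structure on R is only the Borel
   one. This is the domain type of completed_lebesgue_measure. *)
Notation lebesgueR R :=
  (caratheodory_type ((wlength (@idfun R))^*)%mu) (only parsing).

(* The complex numbers with their Borel sigma-algebra; R[i] has no canonical
   topology, the one given by the modulus is carried by R[i]^o. *)
Notation borelC R := (g_sigma_algebraType (@open R[i]^o)) (only parsing).

Definition lebesgue_measurable_funC (R : realType) (f : R -> R[i]) : Prop :=
  measurable_fun [set: lebesgueR R] (f : lebesgueR R -> borelC R).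

Definition supp (R : realType) (f : R -> R[i]) : set R := [set x | f x != 0].

(* The modulus of R[i] taken in R is normc; the norm `|z| lives in R[i]. *)
Definition abs_cvg_seriesZ (R : realType) (a : int -> R[i]) : Prop :=
  (\esum_(k in [set: int]) (Normc.normc (a k))%:E < +oo)%E.

(* The limit is over the finite subsets of int directed by inclusion, so no
   ordering of the terms is involved. *)
Definition series_sumZ (R : realType) (a : int -> R[i]) (s : R[i]) : Prop :=
  partial_sum a @ totally --> (s : R[i]^o).

(* Main.v *)
(* For almost every x, the sequence F j = f (x + j) has sum p over every residue
   class mod n and sum q over every residue class mod m. If F has finite support,
   view each j in it as an edge between its residues mod n and mod m, in a
   bipartite graph on n + m vertices. Since n p = m q with p, q nonzero, this
   graph has at most gcd(n, m) connected components, hence at least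
   n + m - gcd(n, m) edges. So almost every coset of Z meets the support of f
   that many times, and integrating over x in [0, 1) gives the bound. *)
Require Import Defs.
From mathcomp Require Import all_boot all_order all_algebra finmap.
From mathcomp Require Import complex.
From mathcomp Require Import all_classical all_reals all_analysis.
From mathcomp Require Import measurable_realfun summability zify.

Import Order.TTheory GRing.Theory Num.Theory.
Import numFieldNormedType.Exports.

Local Open Scope classical_set_scope.
Local Open Scope ring_scope.

(** * Counting edges of a bipartite graph by linear algebra *)

Lemma card_residue_class (n d a : nat) :
  (0 < d)%N -> (d %| n)%N -> (#|[set i : 'I_n | i == a %[mod d]]%SET| <= n %/ d)%N.
Proof.
move=> d0 dn.
have lt (i : 'I_n) : (i %/ d < n %/ d)%N by rewrite ltn_divLR// divnK.
(* Within one class mod [d], the quotient [i %/ d] determines [i]. *)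
rewrite -[leqRHS]card_ord -(card_in_imset (f := fun i => Ordinal (lt i))).
  exact: max_card.
move=> i j; rewrite !inE => /eqP ia /eqP ja /(congr1 val)/= ij.
by apply/val_inj => /=; rewrite (divn_eq i d) ij ia -ja -divn_eq.
Qed.

(** Used on both sides of the graph: with [Q] the full vertex set it yields n p = m q, with [Q] a
    level set of a kernel vector it yields the mass balance. *)
Lemma sum_fibers (K : pzRingType) (J : finType) (n : nat) (g : J -> 'I_n)
    (F : J -> K) (p : K) (Q : {set 'I_n}) :
  (forall i, \sum_(j | g j == i) F j = p) ->
  \sum_(j | g j \in Q) F j = #|Q|%:R * p.
Proof.
move=> Fp; rewrite (partition_big g (mem Q))//= mulr_natl -sumr_const.
apply: eq_bigr => i iQ; rewrite -(Fp i); apply: eq_bigl => j.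
by case: eqP => [->|_]; rewrite ?andbF// iQ.
Qed.

(* The columns of the matrix A are the edges, together with d extra columns
   reading off u 0, ..., u (d - 1). A vector (u, v) it kills satisfies
   u (g j) = - v (h j) along every edge j. For a residue class mod d, the edges
   where this common value is t carry the mass r p = c q, where r and c count
   the vertices of either side with value t; as n p = m q, r m = c n, so r is a
   multiple of n / d, hence 0 or the size of the whole class. *)
Lemma card_edges_ge (K : numFieldType) (J : finType) (n m : nat)
    (g : J -> 'I_n) (h : J -> 'I_m) (F : J -> K) (p q : K) :
  (0 < n)%N -> (0 < m)%N -> (p, q) != (0, 0) ->
  (forall j, g j = h j %[mod gcdn n m]) ->
  (forall i, \sum_(j | g j == i) F j = p) ->
  (forall i, \sum_(j | h j == i) F j = q) ->
  (n + m <= #|J| + gcdn n m)%N.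
Proof.
move=> n0 m0 pq0 gh Fp Fq; set d := gcdn n m.
have d0 : (0 < d)%N by rewrite gcdn_gt0 n0.
have npmq : n%:R * p = m%:R * q.
  have := sum_fibers _ _ _ _ _ _ [set: 'I_n]%SET Fp.
  have := sum_fibers _ _ _ _ _ _ [set: 'I_m]%SET Fq.
  rewrite !cardsT !card_ord => <- <-.
  by apply: eq_bigl => j; rewrite !inE.
(* If p = 0 then m q = 0, so q = 0 as well, since m is nonzero in [K]. *)
have p0 : p != 0.
  apply: contraNneq pq0 => p0; move: npmq; rewrite p0 mulr0 => /esym/eqP.
  by rewrite mulf_eq0 pnatr_eq0 eqn0Ngt m0/= => /eqP ->.
pose U : 'M[K]_(n, #|J|) := \matrix_(i, k) (g (enum_val k) == i)%:R.
pose V : 'M[K]_(m, #|J|) := \matrix_(i, k) (h (enum_val k) == i)%:R.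
pose E : 'M[K]_(n, d) := \matrix_(i, k) (i == k :> nat)%:R.
pose A := block_mx U E V 0.
(* [A] has n + m rows and #|J| + d columns, so independent rows give the bound. *)
suff /eqP <- : row_free A by exact: rank_leq_col.
rewrite -kermx_eq0; apply/rowV0P => w /sub_kermxP.
rewrite -[w]hsubmxK; move: (lsubmx w) (rsubmx w) => u v.
rewrite mul_row_block mulmx0 addr0 -[0]hsubmxK => /eq_row_mx[].
rewrite !linear0 => uv uE.
have uvj j : u 0 (g j) = - v 0 (h j).
  move/rowP/(_ (enum_rank j)): uv; rewrite !mxE.
  rewrite (bigD1 (g j))//= [X in _ + X + _]big1; last first.
    by move=> i /negbTE gi; rewrite mxE enum_rankK eq_sym gi mulr0.
  rewrite (bigD1 (h j))//= [X in _ + (_ + X)]big1; last first.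
    by move=> i /negbTE gi; rewrite mxE enum_rankK eq_sym gi mulr0.
  by rewrite !mxE !enum_rankK !eqxx !mulr1 !addr0 => /eqP; rewrite addr_eq0 => /eqP.
have ud (i : 'I_n) : (i < d)%N -> u 0 i = 0.
  move=> id; move/rowP/(_ (Ordinal id)): uE; rewrite !mxE.
  rewrite (bigD1 i)//= big1; last first.
    move=> k /negbTE ki; rewrite !mxE/=.
    by rewrite -[_ == _ :> nat]/(k == i) ki mulr0.
  by rewrite !mxE/= eqxx mulr1 addr0.
pose Ru a t := [set i : 'I_n | (i == a %[mod d]) && (u 0 i == t)]%SET.
pose Rv a t := [set i : 'I_m | (i == a %[mod d]) && (v 0 i == - t)]%SET.
have balance a t : (#|Ru a t| * m = #|Rv a t| * n)%N.
  have eqF : #|Ru a t|%:R * p = #|Rv a t|%:R * q.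
    rewrite -(sum_fibers _ _ _ _ _ _ _ Fp) -(sum_fibers _ _ _ _ _ _ _ Fq).
    by apply: eq_bigl => j; rewrite !inE gh uvj eqr_oppLR.
  apply/eqP; rewrite -(eqr_nat K); apply/eqP; apply: (mulIf p0).
  rewrite !natrM -[RHS]mulrA npmq.
  by rewrite mulrAC eqF mulrAC -mulrA.
have u0 i : u 0 i = 0.
  (* The representative [i %% d] is one of the [d] indices where [u] is forced to vanish. So the
     zero level of [u] in the class of [i] is nonempty, and being a multiple of n / d it fills the
     class. *)
  have lt : (i %% d < n)%N by rewrite (leq_ltn_trans (leq_mod _ _)).
  have i0 : Ordinal lt \in Ru i 0.
    by rewrite inE/= modn_mod eqxx ud ?eqxx//= ltn_mod.
  have dvd : (n %/ d %| #|Ru i 0%R|)%N.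
    have cop : coprime (n %/ d) (m %/ d).
      by rewrite /coprime -(eqn_pmul2r d0) muln_gcdl !divnK ?dvdn_gcdl ?dvdn_gcdr// mul1n.
    rewrite -(Gauss_dvdl _ cop); apply/dvdnP; exists #|Rv i 0%R|.
    by rewrite !muln_divA ?dvdn_gcdr ?dvdn_gcdl// balance.
  have /eqP RE : Ru i 0 == [set k : 'I_n | k == i %[mod d]]%SET.
    rewrite eqEcard; apply/andP; split.
      by apply/fintype.subsetP => k; rewrite !inE => /andP[].
    apply: leq_trans (card_residue_class _ _ _ d0 (dvdn_gcdl _ _)) _.
    by apply: dvdn_leq dvd; apply/card_gt0P; exists (Ordinal lt).
  have : i \in Ru i 0 by rewrite RE inE.
  by rewrite inE => /andP[_ /eqP].
(* A nonzero value of [v] would, by [balance], make some value of [u] nonzero. *)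
have v0 i : v 0 i = 0.
  apply/eqP; apply: contraT => vi0.
  have : (0 < #|Rv i (- v 0 i)%R| * n)%N.
    rewrite muln_gt0 n0 andbT; apply/card_gt0P; exists i.
    by rewrite inE opprK !eqxx.
  rewrite -balance muln_gt0 => /andP[/card_gt0P[k]].
  by rewrite inE u0 [0 == _]eq_sym oppr_eq0 (negbTE vi0) andbF.
by rewrite (_ : u = 0) 1?(_ : v = 0) ?row_mx0//; apply/rowP => i; rewrite ?u0 ?v0 mxE.
Qed.

(** * From unordered series to finite sums over residue classes *)

Lemma series_sumZ_finite (R : realType) (a : int -> R[i]) (s : R[i])
    (A : {fset int}) :
  (forall k, a k != 0 -> k \in A) -> series_sumZ a s ->
  \sum_(k <- A) a k = s.
Proof.
move=> aA als.
have hausC : hausdorff_space R[i]^o by exact: norm_hausdorff.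
have totF := @totally_filter int.
(* Partial sums are constant on the finite sets containing [A], and limits in a Hausdorff space are
   unique. *)
have alA : partial_sum a @ totally --> (\sum_(k <- A) a k : R[i]^o).
  apply: (@cvg_near_cst _ R[i]^o _ (partial_sum a) totally); exists A => //= B AB.
  rewrite /partial_sum (big_fset_incl _ AB)/= ?big_seq_fsetE//.
  by move=> k _ kA; apply/eqP; apply: contraNT kA; exact: aA.
exact: (@cvg_unique R[i]^o hausC (partial_sum a @ totally) _ _ s alA als).
Qed.

Lemma sum_residue_class (R : realType) (n : nat) (F : int -> R[i]) (p : R[i])
    (S : {fset int}) (i : int) : (0 < n)%N ->
  (forall j, F j != 0 -> j \in S) ->
  series_sumZ (fun k => F (i - k * n%:Z)) p ->
  \sum_(j <- S | (j == i %[mod n])%Z) F j = p.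
Proof.
move=> n0 FS; have nZ : n%:Z != 0 by rewrite eqz_nat -lt0n.
set t := [seq j <- S | (j == i %[mod n])%Z].
(* The inverse of k |-> i - k n on the residue class of [i]; it reindexes the series by the class
   itself. *)
pose e (j : int) := ((i - j) %/ n)%Z.
have eK j : (j == i %[mod n])%Z -> i - e j * n%:Z = j.
  by rewrite eq_sym eqz_mod_dvd => /divzK ->; rewrite subKr.
pose A := [fset k in map e t]%fset.
have tA : perm_eq A (map e t).
  apply: uniq_perm; first exact: fset_uniq.
    rewrite map_inj_in_uniq ?filter_uniq ?fset_uniq//.
    move=> j k; rewrite !mem_filter => /andP[ji _] /andP[ki _] ejk.
    by rewrite -(eK j)// -(eK k)// ejk.
  by move=> k; rewrite !inE.
move=> /(@series_sumZ_finite _ _ _ A) <-; last first.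
  move=> k Fk; rewrite !inE; apply/mapP; exists (i - k * n%:Z).
    rewrite mem_filter FS// andbT eqz_mod_dvd addrAC subrr add0r.
    by rewrite rpredN dvdz_mull.
  by rewrite /e subKr mulzK.
rewrite (perm_big _ tA)/= big_map big_filter.
by apply: eq_bigr => j /eK ->.
Qed.

(** Stating the bound through a finite subset [B] of the support covers infinite supports too, where
    subsets of every finite size exist. *)
Lemma card_support_ge (R : realType) (n m : nat) (p q : R[i]) (F : int -> R[i]) :
  (0 < n)%N -> (0 < m)%N -> (p, q) != (0, 0) ->
  (forall i, series_sumZ (fun k => F (i - k * n%:Z)) p) ->
  (forall i, series_sumZ (fun k => F (i - k * m%:Z)) q) ->
  exists2 B : {fset int}, forall k, k \in B -> F k != 0 &
    (n + m - gcdn n m <= #|` B|)%N.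
Proof.
move=> n0 m0 pq0 Fp Fq.
have [fin|/(infinite_set_fset (n + m - gcdn n m)) [B BF ?]] :=
  pselect (finite_set [set k | F k != 0]); last by exists B => // k /BF.
pose B := fset_set [set k | F k != 0].
have FB k : (k \in B) = (F k != 0) by rewrite in_fset_set// mem_setE.
exists B; first by move=> k; rewrite FB.
have res_lt l (j : int) : (0 < l)%N -> (`|j %% l|%Z < l)%N.
  by move=> l0; rewrite -ltz_nat gez0_abs ?modz_ge0 ?ltz_pmod//; lia.
pose res l l0 j : 'I_l := Ordinal (res_lt l j l0).
have resE l l0 (j : int) : (res l l0 j : int) = (j %% l)%Z.
  by rewrite /= gez0_abs// modz_ge0//; lia.
have sumE l l0 r : (forall i, series_sumZ (fun k => F (i - k * l%:Z)) r) ->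
    forall i : 'I_l, \sum_(j : B | res l l0 (val j) == i) F (val j) = r.
  move=> Fr i; rewrite -(sum_residue_class _ _ _ _ B i%:Z l0 _ (Fr i)); last first.
    by move=> j; rewrite FB.
  rewrite big_seq_fsetE/=; apply: eq_bigl => j.
  rewrite -(inj_eq val_inj) -eqz_nat resE.
  by rewrite [in RHS]modz_nat modn_small.
(* Reducing mod [l] preserves the class mod any divisor of [l], so both endpoints of an edge agree
   mod gcd(n, m). *)
have resd l l0 j d : (d %| l)%N -> (res l l0 j %% d)%N = (j %% d)%Z :> int.
  move=> dl; rewrite -modz_nat resE; apply/eqP; rewrite eqz_mod_dvd.
  by rewrite -rpredN opprB {1}(divz_eq j l) addrK dvdz_mull.
rewrite leq_subLR cardfE [X in (_ <= X)%N]addnC.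
apply: (card_edges_ge _ _ _ _ (res n n0 \o val) (res m m0 \o val)
  (fun j : B => F (val j)) p q n0 m0 pq0 _ (sumE _ _ _ Fp) (sumE _ _ _ Fq)).
move=> j /=; apply/eqP; rewrite -eqz_nat; apply/eqP.
by rewrite !resd ?dvdn_gcdl ?dvdn_gcdr.
Qed.

(** * Translation invariance, and passage from Lebesgue to Borel sets *)

Lemma measurable_translate (R : realType) (A : set (measurableTypeR R)) (t : R) :
  measurable A ->
  measurable ((fun x : measurableTypeR R => x + t : measurableTypeR R) @^-1` A).
Proof.
move=> mA; rewrite -[X in measurable X]setTI.
have mt : measurable_fun setT (fun x : measurableTypeR R => x + t).
  exact: measurable_funD.
exact: mt.
Qed.

(** The pushforward under translation gives every half-open interval its length, which characterizes
    Lebesgue measure. *)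
Lemma lebesgue_measure_translate (R : realType) (A : set R) (t : R) :
  measurable A ->
  lebesgue_measure ((fun x => x + t) @^-1` A) = lebesgue_measure A.
Proof.
move=> mA.
have mt : measurable_fun setT (fun x : measurableTypeR R => x + t).
  exact: measurable_funD.
rewrite -[LHS]/(pushforward lebesgue_measure
  ((fun x => x + t) : _ -> measurableTypeR R) A).
apply/esym/lebesgue_measure_unique => //= _ [[a b]] _ <-/=.
rewrite /pushforward [X in _ = lebesgue_measure X](_ : _ = `]a - t, b - t]%classic).
  by rewrite !lebesgue_measure_itv/= !lte_fin ltrD2r -!EFinB opprB addrA subrK.
by apply/seteqP; split => x /=; rewrite !in_itv/= ltrBlDr lerBrDr.
Qed.

(** The Caratheodory sigma-algebra is the completion of the Borel one: [E] is a Borel set together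
    with a subset of a Borel null set. This reduces the problem to Borel sets, for which translation
    invariance is established above. *)
Lemma caratheodory_borel (R : realType) (E : set R) :
  measurable (E : set (lebesgueR R)) ->
  exists X M : set (measurableTypeR R), [/\ measurable X, measurable M,
    X `<=` E, E `<=` X `|` M & lebesgue_measure M = 0%E].
Proof.
rewrite -[measurable _]/(((wlength (@idfun R))^*)%mu.-cara.-measurable E).
rewrite -completed_caratheodory_measurable g_sigma_completed_algebra_genE.
move=> [X mX [N [M [mM M0 NM]] <-]].
exists X, M; split=> //.
exact: setUS.
Qed.

Lemma ae_completed (R : realType) (P : R -> Prop) :
  {ae @completed_lebesgue_measure R, forall x, P x} ->
  {ae @lebesgue_measure R, forall x, P x}.
Proof.
move=> [A [mA A0 PA]].
have [X [M [mX mM XA AXM M0]]] := caratheodory_borel R A mA.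
(* Both measures are restrictions of the same outer measure, which is monotone. *)
have X0 : lebesgue_measure X = 0%E.
  apply/eqP; rewrite -measure_le0 -A0.
  exact: (le_outer_measure (((wlength (@idfun R))^*)%mu : {outer_measure set _ -> \bar _})).
exists (X `|` M); split; first exact: measurableU.
  by rewrite measureU0.
exact: subset_trans PA AXM.
Qed.

Lemma ae_translate (R : realType) (P : R -> Prop) (t : R) :
  {ae @lebesgue_measure R, forall x, P x} ->
  {ae @lebesgue_measure R, forall x, P (x + t)}.
Proof.
move=> [A [mA A0 PA]]; exists ((fun x => x + t) @^-1` A); split.
- exact: measurable_translate.
- by rewrite lebesgue_measure_translate.
- by move=> x; exact: PA.
Qed.

Lemma supp_measurable (R : realType) (f : R -> R[i]) :
  lebesgue_measurable_funC f -> measurable (supp f : set (lebesgueR R)).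
Proof.
move=> mf; have hausC : hausdorff_space R[i]^o by exact: norm_hausdorff.
rewrite -[X in measurable X]setTI.
apply: (mf measurableT [set z : R[i] | z != 0]).
apply: sub_sigma_algebra.
rewrite [X in open X](_ : _ = ~` [set 0 : R[i]^o]); last first.
  by apply/seteqP; split => z /= /eqP.
apply: closed_openC; apply: accessible_closed_set1.
exact: hausdorff_accessible.
Qed.

(** * Integrating the number of points of a set in the cosets of Z *)

(** Countable unions and series below are indexed by [nat], so the integers are enumerated: even
    indices give the nonnegative ones, odd indices the negative ones. *)
Definition int_enum (k : nat) : int := if odd k then Negz k./2 else Posz k./2.

Lemma int_enum_surj (j : int) : exists k, int_enum k = j.
Proof.
case: j => i; [exists i.*2|exists i.*2.+1]; rewrite /int_enum/= odd_double/=.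
  by rewrite doubleK.
by rewrite uphalf_double.
Qed.

Lemma int_enum_inj : injective int_enum.
Proof.
move=> k l; rewrite -{2}(odd_double_half k) -{2}(odd_double_half l) /int_enum.
by case: (odd k) (odd l) => -[] // [->].
Qed.

Lemma nneseries_indic_ge (R : realType) (A : nat -> set R) (x : R) (c : nat)
    (s : seq nat) :
  uniq s -> (c <= size s)%N -> (forall k, k \in s -> A k x) ->
  ((c%:R : R)%:E <= \sum_(k <oo) (\1_(A k) x : R)%:E)%E.
Proof.
move=> us cs sA; pose K := (\max_(k <- s) k).+1.
(* [K] exceeds every index in [s], so the truncated sum already counts all of [s]. *)
apply: le_trans (nneseries_lim_ge K _); last by move=> k _; rewrite lee_fin.
rewrite sumEFin lee_fin.
under eq_bigr do rewrite indicE.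
rewrite -natr_sum ler_nat (leq_trans cs)//.
under eq_bigr => i _ do rewrite (_ : nat_of_bool _ = if x \in A i then 1%N else 0%N)//.
rewrite -big_mkcond/= sum1_count -size_filter.
apply: uniq_leq_size => // k ks; rewrite mem_filter mem_index_iota/= mem_set/=; last exact: sA.
by rewrite ltnS; apply: leq_bigmax_seq.
Qed.

(** Cut [X] into its pieces in the intervals [j, j + 1) and translate each back to [0, 1). The
    measures of the pieces add up to the integral over [0, 1) of the number of points of [X] in the
    coset of x, which is at least [c] almost everywhere. *)
Lemma measure_ge_count (R : realType) (X : set (measurableTypeR R)) (c : nat) :
  measurable X ->
  {ae @lebesgue_measure R, forall x,
    exists2 B : {fset int}, forall k, k \in B -> X (x + k%:~R) &
      (c <= #|` B|)%N} ->
  ((c%:R : R)%:E <= lebesgue_measure X)%E.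
Proof.
move=> mX [N [mN N0 XN]].
pose Xk k := (fun x : R => x + (int_enum k)%:~R) @^-1` X.
pose I k : set (measurableTypeR R) :=
  `[(int_enum k)%:~R, (int_enum k)%:~R + 1[%classic.
pose U : set (measurableTypeR R) := `[0, 1[%classic.
pose D := U `\` N.
have mI k : measurable (I k) by exact: measurable_itv.
have mU : measurable U by exact: measurable_itv.
have mD : measurable D by exact: measurableD.
have mXk k : measurable (Xk k : set (measurableTypeR R)).
  exact: measurable_translate.
(* Removing the exceptional null set keeps full measure and makes the count valid at every point of
   [D]. *)
have D1 : lebesgue_measure D = 1%E.
  have U1 : lebesgue_measure U = 1%E.
    by rewrite lebesgue_measure_itv/= lte_fin ltr01 sube0.
  have Uoo : (lebesgue_measure U < +oo)%E by rewrite U1 ltry.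
  rewrite measureD//=.
  rewrite U1 (@subset_measure0 _ _ _ _ _ N) ?sube0//.
  exact: measurableI.
have tI : trivIset setT (fun k => X `&` I k).
  apply/trivIsetP => k l _ _ kl; rewrite -subset0 => x [[_ /=]].
  rewrite /I/= in_itv/= => /andP[k1 k2] [_].
  rewrite in_itv/= => /andP[l1 l2]; move: kl; apply/negP; rewrite negbK.
  have := le_lt_trans k1 l2; have := le_lt_trans l1 k2.
  rewrite -!(intrD _ _ 1) !ltr_int => ? ?.
  by apply/eqP/int_enum_inj; lia.
apply: (@le_trans _ _ (\sum_(k <oo) lebesgue_measure (X `&` I k))%E); last first.
  rewrite [leLHS](_ : _ = lebesgue_measure (\bigcup_k (X `&` I k))); last first.
    rewrite measure_bigcup//; last by move=> k _; exact: measurableI.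
    by apply: eq_eseriesl => k; rewrite in_setT.
  apply: le_measure; rewrite ?inE//.
    by apply: bigcup_measurable => k _; exact: measurableI.
  by move=> x [k _ []].
(* Translating by [int_enum k] carries [Xk k] within [D] into the piece of [X] in [I k]. *)
apply: (@le_trans _ _ (\sum_(k <oo) lebesgue_measure (Xk k `&` D))%E); last first.
  apply: lee_nneseries => // k _.
  have mXI := measurableI _ _ mX (mI k).
  rewrite -[leRHS](lebesgue_measure_translate _ _ (int_enum k)%:~R)//.
  apply: le_measure; rewrite ?inE//; first exact: measurableI.
    exact: measurable_translate.
  move=> x [Xx []]; rewrite {1}/U/= in_itv/= => /andP[x0 x1] _; split=> //.
  by rewrite /I/= in_itv/= lerDr x0 [x + _]addrC ltrD2l.
(* Each measure is the integral of an indicator; nonnegativity permits exchanging sum and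
   integral. *)
have -> : (\sum_(k <oo) lebesgue_measure (Xk k `&` D) =
    \int[lebesgue_measure]_(x in D) \sum_(k <oo) (\1_(Xk k) x)%:E)%E.
  rewrite integral_nneseries//.
  - by apply: eq_eseriesr => k _; rewrite integral_indic.
  - by move=> k; apply/measurable_EFinP; exact: measurable_indic.
have <- : (\int[lebesgue_measure]_(x in D) c%:R%:E = c%:R%:E :> \bar R)%E.
  by rewrite integral_cst//= D1 mule1.
apply: ge0_le_integral => //.
- apply: (ge0_emeasurable_sum (P := xpredT)) => [k x _ _|k _]; first by rewrite lee_fin.
  by apply/measurable_EFinP; exact: measurable_indic.
- move=> x [_ Nx].
  have [B BX cB] : exists2 B : {fset int}, forall k, k \in B -> X (x + k%:~R) &
      (c <= #|` B|)%N.
    by apply: contrapT => ?; apply: Nx; exact: XN.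
  pose g (j : int) := sval (cid (int_enum_surj j)).
  have gK : cancel g int_enum by move=> j; rewrite /g; case: cid.
  apply: (nneseries_indic_ge _ _ _ _ (map g B)).
  + by rewrite map_inj_uniq ?fset_uniq//; exact: can_inj gK.
  + by rewrite size_map.
  + by move=> _ /mapP[j jB ->]; rewrite /Xk/= gK; exact: BX.
Qed.

Theorem theorem2p9 (R : realType) (n m : nat) (p q : R[i]) (f : R -> R[i])
  (n_gt0 : (0 < n)%N) (m_gt0 : (0 < m)%N) (pq_neq0 : (p, q) != (0, 0))
  (mf : lebesgue_measurable_funC f)
  (abs_n : {ae @completed_lebesgue_measure R, forall x : R,
     abs_cvg_seriesZ (fun k : int => f (x - k%:~R * n%:R))})
  (abs_m : {ae @completed_lebesgue_measure R, forall x : R,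
     abs_cvg_seriesZ (fun k : int => f (x - k%:~R * m%:R))})
  (sum_n : {ae @completed_lebesgue_measure R, forall x : R,
     series_sumZ (fun k : int => f (x - k%:~R * n%:R)) p})
  (sum_m : {ae @completed_lebesgue_measure R, forall x : R,
     series_sumZ (fun k : int => f (x - k%:~R * m%:R)) q}) :
  ((n%:R + m%:R - (gcdn n m)%:R)%:E
     <= @completed_lebesgue_measure R (supp f))%E.
Proof.
(* The support is replaced by a Borel subset [X] that misses only points of the null set [M]. *)
have [X [M [mX mM XS SXM M0]]] := caratheodory_borel _ _ (supp_measurable _ _ mf).
have aeM : {ae @lebesgue_measure R, forall x, ~ M x}.
  by exists M; split=> // x /=; exact: contrapT.
pose G y := [/\ series_sumZ (fun k : int => f (y - k%:~R * n%:R)) p,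
  series_sumZ (fun k : int => f (y - k%:~R * m%:R)) q & ~ M y].
have aeF := @ae_filter_ringOfSetsType _ (measurableTypeR R) R lebesgue_measure.
have aeG : {ae @lebesgue_measure R, forall x, G x}.
  apply: (filterS3 aeF _) (ae_completed _ _ sum_n) (ae_completed _ _ sum_m) aeM.
  by move=> x fn fm Mx; exact: And3 fn fm Mx.
(* A countable union of translated null sets is null, so for almost every x the good property [G]
   holds on the whole coset x + Z. *)
have {aeG} aeG : {ae @lebesgue_measure R, forall x, forall k,
    G (x + (int_enum k)%:~R)}.
  by apply: ae_foralln => k; exact: ae_translate aeG.
apply: (@le_trans _ _ (lebesgue_measure X)); last first.
  exact: (le_outer_measure
    (((wlength (@idfun R))^*)%mu : {outer_measure set _ -> \bar R})).
(* The real difference is a natural number because gcd(n, m) <= n. *)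
rewrite -natrD -natrB; last first.
  by rewrite (leq_trans _ (leq_addr _ _))// dvdn_leq ?dvdn_gcdl.
apply: measure_ge_count mX _; apply: (@filterS _ _ aeF _ _ _ aeG) => x Gx.
have Gj (j : int) : G (x + j%:~R) by have [k <-] := int_enum_surj j.
have shift r (j : int) (l : nat) :
    series_sumZ (fun k : int => f (x + j%:~R - k%:~R * l%:R)) r ->
    series_sumZ (fun k : int => f (x + (j - k * l%:Z)%:~R)) r.
  by congr series_sumZ; apply/funext => k; rewrite intrB intrM addrA.
have [|j|B Bf cB] :=
  card_support_ge _ _ _ p q (fun j : int => f (x + j%:~R)) n_gt0 m_gt0 pq_neq0.
- by move=> j; have [Gn _ _] := Gj j; exact: shift Gn.
- by have [_ Gm _] := Gj j; exact: shift Gm.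
(* Points of the coset avoid [M], so those in the support lie in [X]. *)
exists B => // k kB; have [_ _ nM] := Gj k.
by have [] := SXM _ (Bf k kB).
Qed.
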